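(* Let $n\in\mathbb{N}$. Let $P_n=\begin{bmatrix}1&\mathbf{0}\\ \mathbf{0}&0\end{bmatrix}$ and $Q_n=\begin{bmatrix}0&\mathbf{0}\\ \mathbf{0}&1\end{bmatrix}$ be the constant sections in the Pedersen-Petersen C*-algebra $\mathfrak{P}_n$. If $T\in\mathfrak{P}_n$ is a sum of $n$ *-commutators, then $\|T-(P_n-Q_n)\|=1$.
   Context: For $n\in\mathbb{N}$, $\mathbb{C}P^n$ is $n$-dimensional complex projective space, i.e. the space of one-dimensional subspaces $x$ of $\mathbb{C}^{n+1}$ with its natural topology, and $\mathfrak{P}_n$ is the C*-algebra of continuous sections of the bundle over $\mathbb{C}P^n$ $$B_n=\left\{\left(x,\begin{bmatrix}a&\mathbf{b}\\ \mathbf{c}&d\end{bmatrix}\right):x\in\mathbb{C}P^n;\ a,d\in\mathbb{C};\ \mathbf{b},\overline{\mathbf{c}}\in x\right\},$$ where $\overline{\mathbf{c}}=(\overline{c}_1,\ldots,\overline{c}_{n+1})$, with pointwise multiplication and involution $$\begin{bmatrix}a&\mathbf{b}\\ \mathbf{c}&d\end{bmatrix}\begin{bmatrix}a'&\mathbf{b}'\\ \mathbf{c}'&d'\end{bmatrix}=\begin{bmatrix}aa'+\mathbf{b}\cdot\mathbf{c}'&a\mathbf{b}'+d'\mathbf{b}\\ a'\mathbf{c}+d\mathbf{c}'&dd'+\mathbf{b}'\cdot\mathbf{c}\end{bmatrix},\qquad \begin{bmatrix}a&\mathbf{b}\\ \mathbf{c}&d\end{bmatrix}^*=\begin{bmatrix}\overline{a}&\overline{\mathbf{c}}\\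 \overline{\mathbf{b}}&\overline{d}\end{bmatrix},$$ where $\mathbf{u}\cdot\mathbf{v}=\sum_i u_iv_i$ is bilinear. Each fibre is *-isomorphic to $M_2(\mathbb{C})$, and the norm on $\mathfrak{P}_n$ is the supremum over $x\in\mathbb{C}P^n$ of the fibrewise C*-norms. A *-commutator in a C*-algebra $A$ is an element of the form $mm^*-m^*m$ with $m\in A$.
   Formalization: The equality ‖T−(P_n−Q_n)‖=1 fails for n≥1 (with b(x) the projection of e_0 onto x, m=[0 2b; 0 0] gives norm 3); what is proved is ‖T−(P_n−Q_n)‖≥1 for every sum T of n *-commutators, with value 1 attained by some such T (T=0). *)

(* Defs.v *)
From HB Require Import structures.
From mathcomp Require Import all_boot all_order all_algebra.
From mathcomp Require Import complex.
From mathcomp Require Import all_classical all_reals all_analysis.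
From mathcomp Require Import ring.
Set Implicit Arguments.
Unset Strict Implicit.
Unset Printing Implicit Defensive.
Import Order.TTheory GRing.Theory Num.Theory.
Import numFieldNormedType.Exports.
Local Open Scope classical_set_scope.
Local Open Scope ring_scope.

(* The algebra is set up over an arbitrary numClosedFieldType K; the statement
   uses K := C R, the complex numbers over R, defined at the end. *)
Definition dot (K : numClosedFieldType) (n : nat) (u v : 'rV[K]_n) : K :=
  \sum_i u 0 i * v 0 i.

Definition conjv (K : numClosedFieldType) (n : nat) (u : 'rV[K]_n) : 'rV[K]_n :=
  map_mx Num.conj u.

Definition CP (K : numClosedFieldType) (n : nat) : Type :=
  {x : {vspace 'rV[K]_n.+1} | \dim x == 1%N}.

HB.instance Definition _ (K : numClosedFieldType) (n : nat) := Choice.on (CP K n).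

(* The vectors v spanning a line that belongs to U; such a v is nonzero because
   its span has dimension 1. *)
Definition CP_preimage (K : numClosedFieldType) (n : nat) (U : set (CP K n)) :
    set 'rV[K]_n.+1 :=
  [set v | exists2 x, U x & \val x = <[v]>%VS].

(* Quotient topology of K^(n+1) \ {0} -> CP^n (K^(n+1) \ {0} being open, it
   does not matter whether openness is read in it or in K^(n+1)). *)
Definition CP_open (K : numClosedFieldType) (n : nat) : set_system (CP K n) :=
  [set U | open (CP_preimage U)].

Section CP_topology.
Variables (K : numClosedFieldType) (n : nat).

Lemma CP_openT : @CP_open K n setT.
Proof.
rewrite /CP_open /=.
have -> : CP_preimage [set: CP K n] = ~` [set 0].
  apply/seteqP; split => [v [x _ xv] v0|v /eqP v0].
    by have := valP x; rewrite xv v0 dim_vline eqxx.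
  have dv : \dim <[v]>%VS == 1%N by rewrite dim_vline v0.
  by exists (exist (fun x : {vspace 'rV[K]_n.+1} => \dim x == 1%N) _ dv).
apply: closed_openC; apply: accessible_closed_set1.
exact/hausdorff_accessible/norm_hausdorff.
Qed.

Lemma CP_openI : setI_closed (@CP_open K n).
Proof.
rewrite /CP_open => U V /= oU oV.
have -> : CP_preimage (U `&` V) = CP_preimage U `&` CP_preimage V.
  apply/seteqP; split => [v [x [Ux Vx] xv]|v [[x Ux xv] [y Vy yv]]].
    by split; exists x.
  exists x => //; split => //.
  by have -> : x = y by apply: val_inj; rewrite /= xv yv.
exact: openI.
Qed.

Lemma CP_open_bigU (I : Type) (f : I -> set (CP K n)) :
  (forall i, CP_open (f i)) -> CP_open (\bigcup_i f i).
Proof.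
rewrite /CP_open /= => of_.
have -> : CP_preimage (\bigcup_i f i) = \bigcup_i CP_preimage (f i).
  apply/seteqP; split => [v [x [i _ fx] xv]|v [i _ [x fx xv]]].
    by exists i => //; exists x.
  by exists x => //; exists i.
exact: bigcup_open.
Qed.

HB.instance Definition _ :=
  isOpenTopological.Build (CP K n) CP_openT CP_openI CP_open_bigU.

End CP_topology.

(* ((a, b), (c, d)) stands for the array [a b; c d]. The product topology on
   this type makes B_n a subspace of CP K n * entries K n. *)
Notation entries K n :=
  ((K * 'rV[K]_n.+1) * ('rV[K]_n.+1 * K))%type.

Section Fibre.
Variables (K : numClosedFieldType) (n : nat).
Implicit Types (M N : entries K n) (x : CP K n).

Definition fibre x : set (entries K n) :=
  [set M | M.1.2 \in \val x /\ conjv M.2.1 \in \val x].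

Definition fmul M N : entries K n :=
  let: ((a, b), (c, d)) := M in let: ((a', b'), (c', d')) := N in
  ((a * a' + dot b c', a *: b' + d' *: b),
   (a' *: c + d *: c', d * d' + dot b' c)).

Definition fstar M : entries K n :=
  let: ((a, b), (c, d)) := M in
  ((Num.conj a, conjv c), (conjv b, Num.conj d)).

(* The array [a b; c d] over x acts on the two-dimensional Hilbert space
   K (+) conj(x); by frep_mul, frep_star and frep_inj this is a faithful
   *-representation of the fibre, so its operator norm is the C*-norm. *)
Definition frep M (p : K * 'rV[K]_n.+1) : K * 'rV[K]_n.+1 :=
  let: ((a, b), (c, d)) := M in
  (a * p.1 + dot b p.2, p.1 *: c + d *: p.2).

Definition hinner (p q : K * 'rV[K]_n.+1) : K :=
  p.1 * Num.conj q.1 + dot p.2 (conjv q.2).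

Definition hspace x : set (K * 'rV[K]_n.+1) :=
  [set p | conjv p.2 \in \val x].

Lemma CP_line x : exists w, \val x = <[w]>%VS.
Proof.
exists (vpick (\val x)); apply/eqP.
rewrite eq_sym eqEdim -memvE memv_pick dim_vline (eqP (valP x)) vpick0.
by rewrite -dimv_eq0 (eqP (valP x)).
Qed.

Lemma dotDl (u v w : 'rV[K]_n.+1) : dot (u + v) w = dot u w + dot v w.
Proof. by rewrite -big_split; apply: eq_bigr => i _; rewrite !mxE mulrDl. Qed.

Lemma dotDr (u v w : 'rV[K]_n.+1) : dot u (v + w) = dot u v + dot u w.
Proof. by rewrite -big_split; apply: eq_bigr => i _; rewrite !mxE mulrDr. Qed.

Lemma dotZl k (u v : 'rV[K]_n.+1) : dot (k *: u) v = k * dot u v.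
Proof. by rewrite /dot mulr_sumr; apply: eq_bigr => i _; rewrite !mxE mulrA. Qed.

Lemma dotZr k (u v : 'rV[K]_n.+1) : dot u (k *: v) = k * dot u v.
Proof. by rewrite /dot mulr_sumr; apply: eq_bigr => i _; rewrite !mxE mulrCA. Qed.

Lemma dotC (u v : 'rV[K]_n.+1) : dot u v = dot v u.
Proof. by apply: eq_bigr => i _; rewrite mulrC. Qed.

Lemma conj_dot (u v : 'rV[K]_n.+1) :
  Num.conj (dot u v) = dot (conjv u) (conjv v).
Proof. by rewrite rmorph_sum; apply: eq_bigr => i _; rewrite !mxE rmorphM. Qed.

Lemma conjvK : involutive (@conjv K n.+1).
Proof. by move=> u; apply/rowP => i; rewrite !mxE conjCK. Qed.

Lemma conjvD (u v : 'rV[K]_n.+1) : conjv (u + v) = conjv u + conjv v.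
Proof. by rewrite /conjv raddfD. Qed.

Lemma conjvZ k (u : 'rV[K]_n.+1) : conjv (k *: u) = Num.conj k *: conjv u.
Proof. by apply/rowP => i; rewrite !mxE rmorphM. Qed.

Lemma dot_cvg (T : Type) (F : set_system T) (FF : Filter F)
    (f g : T -> 'rV[K]_n.+1) u v :
  f @ F --> u -> g @ F --> v -> (fun t => dot (f t) (g t)) @ F --> dot u v.
Proof.
move=> fu gv; rewrite /dot.
apply: (cvg_big add_continuous) => i _.
by apply: cvgM; [apply: (cvg_comp _ (fun M : 'rV[K]_n.+1 => M 0 i) fu)|
  apply: (cvg_comp _ (fun M : 'rV[K]_n.+1 => M 0 i) gv)];
  exact: coord_continuous.
Qed.

Lemma conj_continuous : continuous (fun z : K => Num.conj z).
Proof.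
move=> z; apply/(@cvgrPdist_lt K K^o K (nbhs z) (nbhs_filter z)) => e e0.
apply/nbhs_ballP; exists e => // t.
by rewrite /ball /= -rmorphB norm_conjC.
Qed.

Lemma conjv_continuous : continuous (@conjv K n.+1).
Proof.
move=> /= u s /= /(nbhs_ballP (conjv u)) [e e0 es].
apply/nbhs_ballP; exists e => //= v [_ uv]; apply: es; split => // i j.
by have := uv i j; rewrite /ball /= !mxE -rmorphB norm_conjC.
Qed.

Lemma fibre_mul x M N : fibre x M -> fibre x N -> fibre x (fmul M N).
Proof.
move: M N => [[a b] [c d]] [[a' b'] [c' d']] [/= xb xc] [/= xb' xc'].
by split; rewrite /= ?conjvD ?conjvZ rpredD // rpredZ.
Qed.

Lemma fibre_star x M : fibre x M -> fibre x (fstar M).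
Proof. by move: M => [[a b] [c d]] [/= xb xc]; split; rewrite /= ?conjvK. Qed.

Lemma hspace_frep x M p : fibre x M -> hspace x p -> hspace x (frep M p).
Proof.
move: M p => [[a b] [c d]] [s t] [/= _ xc] xt.
by rewrite /hspace /= conjvD !conjvZ rpredD // rpredZ.
Qed.

Lemma frep_mul x M N p : fibre x M -> fibre x N -> hspace x p ->
  frep (fmul M N) p = frep M (frep N p).
Proof.
move: M N p => [[a b] [c d]] [[a' b'] [c' d']] [s t] [/= _ xc] [/= _ xc'] /= xt.
have /= swap : dot b' t *: c = dot b' c *: t.
  have [w xw] := CP_line x.
  move: xc xt; rewrite /hspace /= xw => /vlineP[k ck] /vlineP[l tl].
  rewrite -(conjvK c) -(conjvK t) ck tl !conjvZ !dotZr !scalerA.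
  congr (_ *: _); ring.
congr pair => /=.
  by rewrite dotDl dotDr !dotZl !dotZr mulrDl !mulrDr; ring.
rewrite !scalerDl !scalerDr !scalerA swap.
rewrite (mulrC s a') (mulrC s d) -!addrA; congr (_ + _).
by rewrite addrA addrC.
Qed.

Lemma frep_star M p q : hinner (frep M p) q = hinner p (frep (fstar M) q).
Proof.
move: M p q => [[a b] [c d]] [s t] [s' t']; rewrite /hinner /=.
rewrite conjvD !conjvZ !rmorphD !rmorphM /= !conj_dot !conjvK !conjCK.
rewrite !dotDl !dotDr !dotZl !dotZr (dotC t b).
ring.
Qed.

Lemma frep_inj x M N : fibre x M -> fibre x N ->
  (forall p, hspace x p -> frep M p = frep N p) -> M = N.
Proof.
have dot0 (u : 'rV[K]_n.+1) : dot u (0 : 'rV[K]_n.+1) = 0.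
  by apply: big1 => i _; rewrite mxE mulr0.
have hs0 s : hspace x (s, 0).
  by rewrite /hspace /= /conjv raddf0 mem0v.
move: M N => [[a b] [c d]] [[a' b'] [c' d']] [/= xb _] [/= xb' _] MN.
have [] := MN _ (hs0 1); rewrite /= !dot0 !mulr1 !addr0 !scaler0 !addr0 !scale1r.
move=> -> ->; have [w xw] := CP_line x.
have w0 : w != 0.
  by apply/eqP => w0; have := valP x; rewrite xw w0 dim_vline eqxx.
have hsw : hspace x (0, conjv w) by rewrite /hspace /= conjvK xw memv_line.
have [] := MN _ hsw; rewrite /= !mulr0 !scale0r !add0r => bb' dd'.
have ww : dot w (conjv w) != 0.
  apply: contra w0 => /eqP ww; apply/eqP/rowP => i; rewrite mxE.
  have /psumr_eq0P : forall i, true -> 0 <= w 0 i * (conjv w) 0 i.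
    by move=> j _; rewrite mxE mul_conjC_ge0.
  move=> /(_ ww i isT) /eqP; rewrite mxE mul_conjC_eq0 => /eqP; exact.
congr (_, _, (_, _)).
  move: xb xb'; rewrite xw => /vlineP[k bk] /vlineP[l bl].
  move: bb'; rewrite bk bl !dotZl => /(mulIf ww) ->; by [].
apply/eqP; rewrite -subr_eq0; apply/eqP.
have /eqP : (d - d') *: conjv w = 0 by rewrite scalerBl dd' subrr.
rewrite scaler_eq0 => /orP[/eqP //|/eqP cw0].
by move: w0; rewrite -(conjvK w) cw0 /conjv raddf0 eqxx.
Qed.

End Fibre.

Section PedersenPetersen.
Variables (K : numClosedFieldType) (n : nat).
Implicit Types f g m T : CP K n -> entries K n.

Definition PP : set (CP K n -> entries K n) :=
  [set f | continuous f /\ forall x, fibre x (f x)].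

Definition PPmul f g : CP K n -> entries K n := fun x => fmul (f x) (g x).

Definition PPstar f : CP K n -> entries K n := fun x => fstar (f x).

Definition star_commutator m : CP K n -> entries K n :=
  PPmul m (PPstar m) - PPmul (PPstar m) m.

Definition sum_of_star_commutators (k : nat) T : Prop :=
  exists m : 'I_k -> CP K n -> entries K n,
    (forall i, PP (m i)) /\ T = \sum_(i < k) star_commutator (m i).

Definition PPp : CP K n -> entries K n := fun=> ((1, 0), (0, 0)).

Definition PPq : CP K n -> entries K n := fun=> ((0, 0), (0, 1)).

Lemma PP_sub f g : PP f -> PP g -> PP (f - g).
Proof.
move=> [cf xf] [cg xg]; split => [x|x]; first exact: cvgB (cf x) (cg x).
move: (xf x) (xg x); rewrite /fibre /=.
move=> [fb fc] [gb gc]; split; rewrite /= ?rpredB //.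
by rewrite /conjv raddfB rpredB.
Qed.

Lemma PP_p : PP PPp.
Proof.
split=> [|x]; first exact: cst_continuous.
by split; rewrite /= /conjv ?raddf0 mem0v.
Qed.

Lemma PP_q : PP PPq.
Proof.
split=> [|x]; first exact: cst_continuous.
by split; rewrite /= /conjv ?raddf0 mem0v.
Qed.

Lemma entries_cvg f x : continuous f ->
  [/\ (f y).1.1 @[y --> x] --> (f x).1.1, (f y).1.2 @[y --> x] --> (f x).1.2,
      (f y).2.1 @[y --> x] --> (f x).2.1 & (f y).2.2 @[y --> x] --> (f x).2.2].
Proof.
move=> cf; split.
- by apply: (cvg_comp _ _ (cvg_comp _ _ (cf x) cvg_fst) cvg_fst).
- by apply: (cvg_comp _ _ (cvg_comp _ _ (cf x) cvg_fst) cvg_snd).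
- by apply: (cvg_comp _ _ (cvg_comp _ _ (cf x) cvg_snd) cvg_fst).
- by apply: (cvg_comp _ _ (cvg_comp _ _ (cf x) cvg_snd) cvg_snd).
Qed.

Lemma PP_mul f g : PP f -> PP g -> PP (PPmul f g).
Proof.
move=> [cf xf] [cg xg]; split => [x|x]; last exact: fibre_mul.
have [f11 f12 f21 f22] := entries_cvg x cf.
have [g11 g12 g21 g22] := entries_cvg x cg.
have -> : PPmul f g = fun y =>
    (((f y).1.1 * (g y).1.1 + dot (f y).1.2 (g y).2.1,
      (f y).1.1 *: (g y).1.2 + (g y).2.2 *: (f y).1.2),
     ((g y).1.1 *: (f y).2.1 + (f y).2.2 *: (g y).2.1,
      (f y).2.2 * (g y).2.2 + dot (g y).1.2 (f y).2.1)).
  apply/funext => y; rewrite /PPmul.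
  by case: (f y) (g y) => [[? ?] [? ?]] [[? ?] [? ?]].
have h11 := cvgD (cvgM f11 g11) (dot_cvg _ f12 g21).
have h12 := cvgD (cvgZ f11 g12) (cvgZ g22 f12).
have h21 := cvgD (cvgZ g11 f21) (cvgZ f22 g21).
have h22 := cvgD (cvgM f22 g22) (dot_cvg _ g12 f21).
have Fx := nbhs_filter x.
exact: (cvg_pair (cvg_pair (h11 Fx Fx Fx) (h12 Fx Fx Fx))
                 (cvg_pair (h21 Fx Fx Fx) (h22 Fx Fx Fx))).
Qed.

Lemma PP_star f : PP f -> PP (PPstar f).
Proof.
move=> [cf xf]; split => [x|x]; last exact: fibre_star.
have -> : PPstar f = fun y =>
    ((Num.conj (f y).1.1, conjv (f y).2.1),
     (conjv (f y).1.2, Num.conj (f y).2.2)).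
  by apply/funext => y; rewrite /PPstar; case: (f y) => [[? ?] [? ?]].
have [f11 f12 f21 f22] := entries_cvg x cf.
have h11 := cvg_comp _ _ f11 (@conj_continuous _ _).
have h12 := cvg_comp _ _ f21 (@conjv_continuous _ _ _).
have h21 := cvg_comp _ _ f12 (@conjv_continuous _ _ _).
have h22 := cvg_comp _ _ f22 (@conj_continuous _ _).
exact: (cvg_pair (cvg_pair h11 h12) (cvg_pair h21 h22)).
Qed.

End PedersenPetersen.

Arguments PP : clear implicits.
Arguments PPp : clear implicits.
Arguments PPq : clear implicits.

(* The complex numbers, with the norm topology that every numFieldType carries
   (the library declares no topology on the bare type complex R). *)
Definition C (R : realType) : numClosedFieldType := complex R.

Section Norm.
Variables (R : realType) (n : nat).

Definition hnorm (p : C R * 'rV[C R]_n.+1) : R :=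
  Num.sqrt (complex.Re (hinner p p)).

Definition fnorm (x : CP (C R) n) (M : entries (C R) n) : \bar R :=
  ereal_sup [set (hnorm (frep M p))%:E | p in
    [set p | hspace x p /\ hnorm p <= 1]].

(* Extended-real valued so that the supremum never takes a default value. *)
Definition PPnorm (f : CP (C R) n -> entries (C R) n) : \bar R :=
  ereal_sup (range (fun x => fnorm x (f x))).

End Norm.

(* Main.v *)
(** At a point x, the (1,1) entry of a sum of *-commutators of sections with
    entries a_i, b_i, c_i, d_i is the sum of the |b_i|^2 - |c_i|^2.  The b_i are n
    sections of the tautological line bundle over CP^n, and they have a common
    zero: pairing b_i([v]) with v gives n odd complex functions of v, to which
    Borsuk-Ulam applies.  There the (1,1) entry of T is at most 0, at distance at
    least 1 from the entry 1 of P - Q.  The value 1 is attained at T = 0.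

    Borsuk-Ulam is obtained from a form of Tucker's lemma without triangulations.
    Chains mod 2 of small tuples of points are built on the octahedral spheres,
    E_(m+1) filling the cycle E_m + (-1)E_m by a straight-line homotopy to a
    pole.  The cochain phi that recognises tuples whose labels, sorted by index,
    have alternating signs satisfies d phi = phi + phi o (-1) on tuples without
    complementary labels, so the pairing of phi + phi o (-1) with E_m does not
    depend on m.  It is 1 for m = 0, and 0 as soon as m is at least the number of
    indices. *)

Require Import Defs.
From mathcomp Require Import all_boot all_order all_algebra.
From mathcomp Require Import complex.
From mathcomp Require Import all_classical all_reals all_analysis.
From mathcomp Require Import zify ring lra.
Set Implicit Arguments.
Unset Strict Implicit.
Unset Printing Implicit Defensive.
Import Order.TTheory GRing.Theory Num.Theory.
Import numFieldNormedType.Exports.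

(** * Cochains mod 2 on tuples, prisms and filling of cycles *)

(** The recursion asks whether the head is the deleted entry. The complex is augmented: the empty
    tuple is the face of a vertex. *)
Fixpoint coboundary (V : Type) (phi : seq V -> bool) (s : seq V) : bool :=
  if s is v :: s' then phi s' (+) coboundary (fun t => phi (v :: t)) s'
  else false.

Lemma coboundary_map (V W : Type) (phi : seq W -> bool) (f : V -> W) s :
  coboundary phi (map f s) = coboundary (fun t => phi (map f t)) s.
Proof. by elim: s phi => //= v s IH phi; rewrite IH. Qed.

Section Cochains.
Variable V : eqType.
Implicit Types (phi psi : seq V -> bool) (f g : V -> V) (s t : seq V).

(** Dual of the prism operator: the sum over i of [phi] at f v_0, ..., f v_i, g v_i, ..., g v_k. *)
Fixpoint prism f g phi s : bool :=
  if s is v :: s' then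
    phi (f v :: g v :: map g s') (+) prism f g (fun t => phi (f v :: t)) s'
  else false.

Lemma eq_coboundary phi psi s :
  (forall t, subseq t s -> phi t = psi t) -> coboundary phi s = coboundary psi s.
Proof.
elim: s phi psi => //= v s IH phi psi e; congr addb.
  by apply: e; exact: subseq_cons.
by apply: IH => t ts; apply: e; rewrite eqxx.
Qed.

Lemma coboundaryD phi psi s :
  coboundary (fun t => phi t (+) psi t) s =
  coboundary phi s (+) coboundary psi s.
Proof. by elim: s phi psi => //= v s IH phi psi; rewrite IH addbACA. Qed.

Lemma eq_prism f g phi psi s :
  (forall t, {subset t <= map f s ++ map g s} -> size t = (size s).+1 ->
     phi t = psi t) ->
  prism f g phi s = prism f g psi s.
Proof.
elim: s phi psi => //= v s IH phi psi e; congr addb.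
  apply: e => [u|]; last by rewrite /= size_map.
  by rewrite !(inE, mem_cat); case/or3P => ->; rewrite ?orbT.
apply: IH => t st szt; apply: e => [u|]; last by rewrite /= szt.
rewrite !(inE, mem_cat) => /orP[->//|/st]; rewrite mem_cat.
by case/orP => ->; rewrite ?orbT.
Qed.

Lemma prismD f g phi psi s :
  prism f g (fun t => phi t (+) psi t) s = prism f g phi s (+) prism f g psi s.
Proof. by elim: s phi psi => //= v s IH phi psi; rewrite IH addbACA. Qed.

(** The chain homotopy formula. In the induction the mixed term [phi (f v :: map g s)] occurs twice
    and cancels. *)
Lemma prism_coboundary f g phi s :
  prism f g (coboundary phi) s =
  coboundary (prism f g phi) s (+) (phi (map f s) (+) phi (map g s)).
Proof.
elim: s phi => [|v s IH] phi /=; first by rewrite addbb.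
rewrite coboundary_map !prismD IH coboundaryD.
move: (phi (_ :: map g s)) (phi (_ :: map g s)) (phi (_ :: map f s)).
move: (prism f g phi s) (coboundary _ s) (coboundary _ s).
by do 6 case.
Qed.

(* A chain with coefficients in F_2 is given by its pairing with cochains; [G]
   holds on the simplices of its support. *)
Definition chain_on (G : seq V -> Prop) (E : (seq V -> bool) -> bool) : Prop :=
  (forall phi psi, E (fun s => phi s (+) psi s) = E phi (+) E psi) /\
  (forall phi psi, (forall s, G s -> phi s = psi s) -> E phi = E psi).

Lemma chain_on0 G E : chain_on G E -> E (fun=> false) = false.
Proof.
move=> [ED EG].
have e : E (fun=> false) = E (fun=> false) (+) E (fun=> false) := ED xpred0 xpred0.
by rewrite e addbb.
Qed.

Lemma chain_on_vertex G v : G [:: v] -> chain_on G (fun phi => phi [:: v]).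
Proof. by move=> Gv; split=> // phi psi; exact. Qed.

(* The prisms of a homotopy H from the identity to a tau-invariant map fill the
   cycle c + tau c: the end of the homotopy identifies c and tau c, which cancel. *)
Lemma chain_fill (tau : V -> V) (H : nat -> V -> V) k (G G' : seq V -> Prop) E :
  chain_on G E ->
  (forall s, G s -> G (map tau s)) ->
  (forall phi, E (coboundary phi) = E (fun s => coboundary phi (map tau s))) ->
  H 0 =1 id -> (forall v, H k (tau v) = H k v) ->
  (forall j s t, j < k -> G s -> size t = (size s).+1 ->
     {subset t <= map (H j) s ++ map (H j.+1) s} -> G' t) ->
  exists E', chain_on G' E' /\
    forall phi, E' (coboundary phi) = E phi (+) E (fun s => phi (map tau s)).
Proof.
move=> [ED EG] Gtau Ecyc H0 Hk GH.
pose Z phi := E phi (+) E (fun s => phi (map tau s)).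
have ZD phi psi : Z (fun s => phi s (+) psi s) = Z phi (+) Z psi.
  by rewrite /Z ED (ED (fun s => phi (map tau s))) addbACA.
have ZG phi psi : (forall s, G s -> phi s = psi s) -> Z phi = Z psi.
  by move=> e; rewrite /Z; congr addb; apply: EG => s Gs; apply: e; auto.
(* [Ecyc] says that c and tau c have the same boundary, so their sum is a cycle. *)
have Zcyc phi : Z (coboundary phi) = false by rewrite /Z Ecyc addbb.
exists (fun phi => \big[addb/false]_(j < k) Z (prism (H j) (H j.+1) phi)).
split=> [|phi].
  split=> [phi psi|phi psi e].
    rewrite -big_split; apply: eq_bigr => j _ /=.
    by rewrite -ZD; apply: ZG => s _; exact: prismD.
  apply: eq_bigr => j _; apply: ZG => s Gs; apply: eq_prism => t st szt.
  exact: e (GH j s t (ltn_ord j) Gs szt st).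
(* Summed over consecutive stages the homotopy formula telescopes; [Zcyc] removes the coboundaries
   of prisms. *)
have tele i : i <= k ->
    \big[addb/false]_(j < i) Z (prism (H j) (H j.+1) (coboundary phi)) =
    Z (fun s => phi (map (H 0) s)) (+) Z (fun s => phi (map (H i) s)).
  elim: i => [_|i IH ik]; first by rewrite big_ord0 addbb.
  rewrite big_ord_recr /= IH ?(ltnW ik) //.
  rewrite (ZG _ _ (fun s _ => prism_coboundary (H i) (H i.+1) phi s)).
  rewrite ZD Zcyc ZD addFb; move: (Z _) (Z _) (Z _); by do 3 case.
rewrite tele // [X in _ (+) X](_ : _ = false) ?addbF.
  by rewrite -/(Z phi); apply: ZG => s _; rewrite (eq_map H0) map_id.
rewrite /Z; set a := E _; rewrite (_ : E _ = a) ?addbb //.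
by apply: EG => s _; rewrite -map_comp (eq_map Hk).
Qed.

End Cochains.

(** * Alternating label sequences *)

(* The label of index i and sign b is coded as 2i + b. *)
Fixpoint alternating (b : bool) (l : seq nat) : bool :=
  if l is x :: l' then (odd x == b) && alternating (~~ b) l' else true.

Definition flip (c : nat) : nat := if odd c then c.-1 else c.+1.

Lemma odd_flip c : odd (flip c) = ~~ odd c.
Proof. by rewrite /flip; case: ifP; lia. Qed.

Lemma coboundary_false (V : eqType) (s : seq V) :
  coboundary (fun=> false) s = false.
Proof. by elim: s. Qed.

(** If the head has sign [b], deleting it gives [alternating b] of the tail, which cancels one of
    the two terms of the induction hypothesis. Otherwise only the deletion of the head can
    contribute. *)
Lemma coboundary_alternating b l :
  coboundary (alternating b) l = alternating true l (+) alternating false l.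
Proof.
elim: l b => //= x l IH b; case: (odd x =P b) => [<-|/eqP xb] /=.
  by rewrite IH; case: (odd x) => /=; case: alternating; case: alternating.
rewrite coboundary_false addbF.
by move: xb; case: (odd x); case: b => //=; rewrite ?addbF.
Qed.

(** With repeated entries [rem] may delete another copy than the recursion does; the results are
    permutations of each other. *)
Lemma coboundary_perm_invariant (V : eqType) (chi : seq V -> bool) s :
  (forall t t', perm_eq t t' -> chi t = chi t') ->
  coboundary chi s = \big[addb/false]_(x <- s) chi (rem x s).
Proof.
elim: s chi => [|v s IH] chi chiP; first by rewrite big_nil.
rewrite big_cons /= eqxx IH => [|t t' tt']; last first.
  by apply: chiP; rewrite perm_cons.
congr addb; apply: eq_big_seq => x xs; apply: chiP.
by case: eqP => [->|_] //; rewrite perm_sym perm_to_rem.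
Qed.


Lemma coboundary_sort (chi : seq nat -> bool) l :
  coboundary (fun t => chi (sort leq t)) l = coboundary chi (sort leq l).
Proof.
have sortP t t' : perm_eq t t' -> sort leq t = sort leq t'.
  by move/(perm_sortP leq_total leq_trans anti_leq).
have sortE : sorted leq (sort leq l) by rewrite sort_sorted //; exact: leq_total.
rewrite coboundary_perm_invariant => [|t t' /sortP -> //].
rewrite (perm_big (sort leq l)) /=; last by rewrite perm_sym perm_sort.
rewrite (eq_bigr (fun x => chi (sort leq (rem x (sort leq l))))) => [|x _];
  last first.
  congr chi; apply: sortP; apply/permP => P.
  have pl : perm_eq l (sort leq l) by rewrite perm_sym perm_sort.
  by rewrite !count_rem (permP pl) (perm_mem pl).
rewrite -(@coboundary_perm_invariant _ (fun t => chi (sort leq t)));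
  last by move=> t t' /sortP ->.
(* A face of a sorted list is a subsequence, hence already sorted. *)
apply: eq_coboundary => t ts; congr chi; apply: sorted_sort; first exact: leq_trans.
exact: (subseq_sorted leq_trans ts sortE).
Qed.

Definition complement_free (l : seq nat) : Prop :=
  {in l &, forall x y, x != flip y}.

(** [flip] exchanges 2i and 2i+1, so it can reverse the order only inside such a pair, and a
    complement-free list never contains both. *)
Lemma sort_flip l :
  complement_free l -> sort leq (map flip l) = map flip (sort leq l).
Proof.
move=> cl; apply: (sorted_eq leq_trans anti_leq).
- by rewrite sort_sorted //; exact: leq_total.
- apply: (@homo_sorted_in _ _ (mem l) flip leq leq); last 2 first.
  + by apply/allP => x; rewrite mem_sort.
  + by rewrite sort_sorted //; exact: leq_total.
  move=> x y xl yl xy; have := cl y x yl xl; rewrite /flip.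
  by case: ifP => ox; case: ifP => oy; lia.
- by rewrite perm_sort perm_map // perm_sym perm_sort.
Qed.

Lemma alternating_flip b l : alternating b (map flip l) = alternating (~~ b) l.
Proof.
elim: l b => //= x l IH b; rewrite odd_flip IH; congr andb.
by case: (odd x); case: b.
Qed.

(** Neighbours have opposite parities; equal halves would then make them complementary. *)
Lemma alternating_sorted_lt b x l :
  complement_free (x :: l) -> path leq x l -> alternating b (x :: l) ->
  path ltn x./2 (map half l).
Proof.
elim: l b x => //= y l IH b x cl /andP[xy yl] /and3P[/eqP ox /eqP oy al].
have xyl := cl y x; rewrite !inE !eqxx ?orbT in xyl.
have /= := xyl isT isT; rewrite /flip => yx.
apply/andP; split.
  by move: yx; case: ifP; lia.
apply: (IH (~~ b)) => //; last by rewrite /= oy eqxx.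
by move=> u v ul vl; apply: cl; rewrite inE ?ul ?vl orbT.
Qed.

(* Alternation forces the indices c./2 of sorted codes c to increase strictly. *)
Lemma alternating_sort_large d b l :
  complement_free l -> (forall c, c \in l -> c./2 < d) -> d < size l ->
  alternating b (sort leq l) = false.
Proof.
move=> cl dl szl; apply/negP => al.
have ss : sorted leq (sort leq l) by rewrite sort_sorted //; exact: leq_total.
have cs : complement_free (sort leq l).
  by move=> x y; rewrite !mem_sort; exact: cl.
have us : uniq (map half (sort leq l)).
  apply: (sorted_uniq ltn_trans ltnn).
  case: (sort leq l) ss cs al => //= x s xs cs al.
  exact: (alternating_sorted_lt cs xs al).
have : size (map half (sort leq l)) <= size (iota 0 d).
  apply: (uniq_leq_size us) => h /mapP[c]; rewrite mem_sort mem_iota => cl' ->.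
  exact: dl.
by rewrite size_map size_sort size_iota leqNgt szl.
Qed.

Local Open Scope classical_set_scope.
Local Open Scope ring_scope.

(** * Chains on octahedral spheres and Tucker's lemma *)

Section Tucker.
Variables (R : realType) (d : nat).
Local Notation V := 'rV[R]_d.+1.
Implicit Types (u v : V) (s t : seq V) (phi : seq V -> bool).

Definition l1 v : R := \sum_i `|v 0 i|.

Lemma l1_ge0 v : 0 <= l1 v.
Proof. by apply: sumr_ge0 => i _; exact: normr_ge0. Qed.

Lemma l1N v : l1 (- v) = l1 v.
Proof. by apply: eq_bigr => i _; rewrite mxE normrN. Qed.

Lemma l1D u v : l1 (u + v) <= l1 u + l1 v.
Proof.
rewrite -big_split; apply: ler_sum => i _; rewrite mxE; exact: ler_normD.
Qed.

Lemma l1Z k v : l1 (k *: v) = `|k| * l1 v.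
Proof. by rewrite mulr_sumr; apply: eq_bigr => i _; rewrite mxE normrM. Qed.

Definition basisv (m : nat) : V := delta_mx 0 (inord m).

Lemma l1_basisv m : l1 (basisv m) = 1.
Proof.
rewrite /l1 (bigD1 (inord m)) //= mxE !eqxx normr1 big1 ?addr0 // => i im.
by rewrite mxE (negbTE im) andbF normr0.
Qed.

Definition octahedral_sphere (m : nat) v : Prop :=
  l1 v = 1 /\ forall i : 'I_d.+1, (m < i)%N -> v 0 i = 0.

Definition small_simplex (m : nat) (e : R) s : Prop :=
  [/\ size s = m.+1, {in s, forall v, octahedral_sphere m v} &
      {in s &, forall u v, l1 (u - v) < e}].

Lemma small_simplexN m e s : small_simplex m e s -> small_simplex m e (map -%R s).
Proof.
move=> [szs ss es]; split; first by rewrite size_map.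
  move=> _ /mapP[v /ss [v1 v0] ->]; split=> [|i /v0]; first by rewrite l1N.
  by rewrite mxE => ->; rewrite oppr0.
by move=> _ _ /mapP[u us ->] /mapP[v vs ->]; rewrite -opprD l1N; exact: es.
Qed.

Definition cone_homotopy (m k j : nat) v : V :=
  (1 - j%:R / k%:R) *: v + (j%:R / k%:R) *: basisv m.

(** [v] and the pole have disjoint supports, so the l1 norm is additive along the segment and stays
    equal to 1 without normalisation. *)
Lemma octahedral_sphere_cone m k j v : (m < d)%N -> (0 < k)%N -> (j <= k)%N ->
  octahedral_sphere m v -> octahedral_sphere m.+1 (cone_homotopy m.+1 k j v).
Proof.
move=> md k0 jk [v1 v0].
have k0' : 0 < k%:R :> R by rewrite ltr0n.
have t0 : 0 <= j%:R / k%:R :> R by rewrite divr_ge0.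
have t1 : 0 <= 1 - j%:R / k%:R :> R.
  by rewrite subr_ge0 ler_pdivrMr // mul1r ler_nat.
set r : R := j%:R / k%:R in t0 t1 *.
have vm : v 0 (inord m.+1) = 0 by apply: v0; rewrite inordK // ltnS.
split=> [|i mi]; last first.
  rewrite !mxE v0 ?(ltnW mi) // eqxx /= (_ : i == _ = false) ?mulr0 ?addr0 //.
  by apply/negP => /eqP ii; move: mi; rewrite ii inordK ?ltnn // ltnS.
transitivity (l1 ((1 - r) *: v) + l1 (r *: basisv m.+1)).
  rewrite -big_split; apply: eq_bigr => i _; rewrite !mxE eqxx /=.
  by case: eqP => [->|_]; rewrite ?vm ?(mulr0, addr0, add0r, normr0).
by rewrite !l1Z v1 l1_basisv !mulr1 !ger0_norm //; lra.
Qed.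

(** The difference is a contraction of [u - v] plus the change of the two weights, each by at most
    1/k on a vector of norm 1. *)
Lemma l1_cone m k j j' u v : (0 < k)%N -> (j <= k)%N ->
  (j' <= j.+1)%N -> (j <= j'.+1)%N -> l1 v = 1 ->
  l1 (cone_homotopy m k j u - cone_homotopy m k j' v)
    <= l1 (u - v) + 2 / k%:R.
Proof.
move=> k0 jk jj' j'j v1.
have k0' : 0 < k%:R :> R by rewrite ltr0n.
have t0 : 0 <= j%:R / k%:R :> R by rewrite divr_ge0.
have t1 : 0 <= 1 - j%:R / k%:R :> R.
  by rewrite subr_ge0 ler_pdivrMr // mul1r ler_nat.
have dt : `|j%:R / k%:R - j'%:R / k%:R| <= k%:R^-1 :> R.
  rewrite -mulrBl normrM [X in _ * X]ger0_norm ?invr_ge0 ?ler0n //.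
  apply: ler_piMl; first by rewrite invr_ge0 ler0n.
  rewrite ler_norml.
  have : (j'%:R <= j%:R + 1 :> R) by rewrite natr1 ler_nat.
  have : (j%:R <= j'%:R + 1 :> R) by rewrite natr1 ler_nat.
  by move=> *; apply/andP; split; lra.
rewrite /cone_homotopy.
set a : R := j%:R / k%:R in t0 t1 dt *; set b : R := j'%:R / k%:R in dt *.
have -> : (1 - a) *: u + a *: basisv m - ((1 - b) *: v + b *: basisv m) =
    (1 - a) *: (u - v) + ((b - a) *: v + (a - b) *: basisv m).
  apply/rowP => i; rewrite !mxE; lra.
apply: le_trans (l1D _ _) _; apply: lerD.
  rewrite l1Z ger0_norm // ler_piMl ?l1_ge0 //; lra.
apply: le_trans (l1D _ _) _; rewrite !l1Z v1 l1_basisv !mulr1 distrC.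
by rewrite mulr_natl mulr2n; apply: lerD.
Qed.

(** The second conjunct makes E + (-1)E a cycle, so that [chain_fill] can build the next chain; the
    third is the invariant that the induction transports. *)
Lemma exists_octahedral_chain phi (e0 : R) :
  (forall s, {in s, forall v, l1 v = 1} -> {in s &, forall u v, l1 (u - v) < e0} ->
     coboundary phi s = phi s (+) phi (map -%R s)) ->
  (forall v, l1 v = 1 -> phi [:: v] (+) phi [:: - v]) ->
  forall m e, (m <= d)%N -> 0 < e <= e0 ->
  exists E, [/\ chain_on (small_simplex m e) E,
    forall psi, E (coboundary psi) = E (fun s => coboundary psi (map -%R s)) &
    E phi (+) E (fun s => phi (map -%R s))].
Proof.
move=> phiD phi0; elim=> [|m IH] e md /andP[e_gt0 ee0].
  exists (fun psi => psi [:: basisv 0]); split=> //; last first.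
    by rewrite /=; exact: phi0 (l1_basisv _).
  apply: chain_on_vertex; split=> // [v|u v]; rewrite !inE => /eqP ->.
    split=> [|i i0]; first exact: l1_basisv.
    rewrite mxE eqxx /=; case: eqP => // ii.
    by move: i0; rewrite ii inordK.
  move=> /eqP ->; rewrite subrr (_ : l1 0 = 0) // /l1 big1 // => i _.
  by rewrite mxE normr0.
have e2 : 0 < e / 2 by rewrite divr_gt0.
have [//||E [Ech Ecyc Ephi]] := IH (e / 2); first exact: ltnW.
  by apply/andP; split; lra.
(* Moving by one stage costs at most 2/k < e/2, on top of the mesh e/2 of the previous chain. *)
pose k := (Num.trunc (4 / e)).+1.
have ke : 2 / k%:R < e / 2.
  have : 4 / e < k%:R by rewrite /k; exact: truncnS_gt.
  rewrite ltr_pdivrMr // => ke.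
  by rewrite ltr_pdivrMr ?ltr0n //; lra.
have k0 : k%:R != 0 :> R by rewrite pnatr_eq0.
have [|v|v|j s t jk [szs ss es] szt st|E' [E'ch E'D]] :=
  @chain_fill _ -%R (cone_homotopy m.+1 k) k _ (small_simplex m.+1 e) E Ech _ Ecyc.
- by move=> s; exact: small_simplexN.
- by rewrite /cone_homotopy mul0r subr0 scale1r scale0r addr0.
- by rewrite /cone_homotopy divff // subrr !scale0r.
- have tP w : w \in t -> exists2 v, v \in s & exists j',
      [/\ (j' <= k)%N, (j <= j' <= j.+1)%N & w = cone_homotopy m.+1 k j' v].
    move/st; rewrite mem_cat => /orP[] /mapP[v vs ->]; exists v => //.
      by exists j; rewrite leqnn leqnSn ltnW.
    by exists j.+1; rewrite leqnn leqnSn.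
  split=> [|w /tP[v /ss vs [i [ik _ ->]]]|].
  + by rewrite szt szs.
  + exact: octahedral_sphere_cone.
  move=> _ _ /tP[u us [i [ik /andP[i1 i2] ->]]]
    /tP[v vs [i' [ik' /andP[i1' i2'] ->]]].
  apply: le_lt_trans (l1_cone _ _ _ _ _ _ _) _ => //; try lia.
    by have [] := ss _ vs.
  have := es _ _ us vs; lra.
exists E'; split=> // [psi|].
  (* The boundary of E' is E + (-1)E, which the antipode preserves. *)
  rewrite E'D (E'ch.2 _ (coboundary (fun s => psi (map -%R s)))) => [|s _].
    rewrite E'D addbC; congr addb; apply: Ech.2 => s _.
    by rewrite -map_comp map_id_in // => v _ /=; rewrite opprK.
  exact: coboundary_map.
(* [E'D] identifies [E' (coboundary phi)] with the invariant of E, and [phiD] identifies it with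
   that of E'. *)
suff <- : E' (coboundary phi) = E' phi (+) E' (fun s => phi (map -%R s)).
  by rewrite E'D.
rewrite -E'ch.1; apply: E'ch.2 => s [_ ss es]; apply: phiD => [v /ss[]//|u v us vs].
exact: lt_le_trans (es _ _ us vs) ee0.
Qed.

(** Without such a pair every tuple of mesh below [e] is complement-free, so the invariant is 1 in
    dimension [d]. But there the simplices carry d+1 labels with only d indices, which cannot
    alternate. *)
Lemma tucker (code : V -> nat) (e : R) :
  0 < e ->
  (forall v, l1 v = 1 -> code (- v) = flip (code v)) ->
  (forall v, l1 v = 1 -> ((code v)./2 < d)%N) ->
  exists u v, [/\ l1 u = 1, l1 v = 1, l1 (u - v) < e & code u = flip (code v)].
Proof.
move=> e0 codeN codelt; apply: contrapT => nex.
pose phi s := alternating true (sort leq (map code s)).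
have cf s : {in s, forall v, l1 v = 1} -> {in s &, forall u v, l1 (u - v) < e} ->
    complement_free (map code s).
  move=> ss es _ _ /mapP[u us ->] /mapP[v vs ->]; apply/eqP => uv; apply: nex.
  by exists u, v; split; [exact: ss|exact: ss|exact: es|].
have phiN s : {in s, forall v, l1 v = 1} -> {in s &, forall u v, l1 (u - v) < e} ->
    phi (map -%R s) = alternating false (sort leq (map code s)).
  move=> ss es; rewrite /phi -map_comp.
  rewrite (_ : map (code \o -%R) s = map flip (map code s)); last first.
    by rewrite -map_comp; apply/eq_in_map => v /ss v1 /=; rewrite codeN.
  by rewrite sort_flip ?alternating_flip //; exact: cf.
have [|v v1||E [Ech _ Ephi]] := @exists_octahedral_chain phi e _ _ d e (leqnn _).
- move=> s ss es; rewrite phiN // /phi.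
  rewrite -(coboundary_map (fun l : seq nat => alternating true (sort leq l))).
  by rewrite coboundary_sort coboundary_alternating.
- by rewrite /phi /= codeN // odd_flip !andbT; case: odd.
- by rewrite e0 lexx.
suff e1 b : E (fun s => alternating b (sort leq (map code s))) = false.
  move: Ephi; rewrite e1.
  rewrite (Ech.2 _ (fun s => alternating false (sort leq (map code s)))).
    by rewrite e1.
  by move=> s [_ ss es]; apply: phiN => // v /ss[].
rewrite -(chain_on0 Ech); apply: Ech.2 => s [szs ss es].
apply: (@alternating_sort_large d).
- by apply: cf => // v /ss[].
- by move=> _ /mapP[v /ss[v1 _] ->]; exact: codelt.
- by rewrite size_map szs.
Qed.

End Tucker.

(** * The Borsuk-Ulam theorem *)

Lemma mx_norm_le_l1 (R : realType) d (v : 'rV[R]_d.+1) : `|v| <= l1 v.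
Proof.
rewrite [leLHS]mx_normrE; apply: bigmax_le => [|[i j] _ /=]; first exact: l1_ge0.
rewrite ord1 /l1 (bigD1 j) //= lerDl; apply: sumr_ge0 => k _; exact: normr_ge0.
Qed.

Lemma l1_cvg (R : realType) d (T : Type) (F : set_system T) (FF : Filter F)
    (f : T -> 'rV[R]_d.+1) u :
  f @ F --> u -> (fun t => l1 (f t)) @ F --> l1 u.
Proof.
move=> fu; rewrite /l1; apply: (cvg_big add_continuous) => i _.
apply: cvg_norm; apply: (cvg_comp _ (fun v : 'rV[R]_d.+1 => v 0 i) fu).
exact: coord_continuous.
Qed.

Lemma compact_l1_sphere (R : realType) d : compact [set v : 'rV[R]_d.+1 | l1 v = 1].
Proof.
apply: bounded_closed_compact.
  exists 1; split; first exact: num_real.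
  move=> M M1 v v1; apply: le_trans (ltW M1).
  by rewrite -v1; exact: mx_norm_le_l1.
apply: (@preimage_closed _ _ (@l1 R d) [set 1]) => [v _|].
  exact: (l1_cvg (nbhs_filter v) (@cvg_id _ (nbhs v))).
exact: closed_eq.
Qed.

(** Each point is labelled by the index and sign of its largest component. Tucker's lemma gives
    close points where this component has opposite signs, against uniform continuity and a positive
    lower bound on the sphere. *)
Lemma borsuk_ulam (R : realType) d (g : 'I_d -> 'rV[R]_d.+1 -> R) :
  (forall j v, v != 0 -> {for v, continuous (g j)}) ->
  (forall j v, v != 0 -> g j (- v) = - g j v) ->
  exists2 v, v != 0 & forall j, g j v = 0.
Proof.
case: d g => [|d] g gc gN.
  exists (const_mx 1); last by case.
  by apply/eqP => /rowP /(_ 0); rewrite !mxE => /eqP; rewrite oner_eq0.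
apply: contrapT => nex.
have l1nz (v : 'rV[R]_d.+2) : l1 v = 1 -> v != 0.
  move=> v1; apply/eqP => v0; move: v1; rewrite v0 /l1 big1 => [/eqP|i _].
    by rewrite eq_sym oner_eq0.
  by rewrite mxE normr0.
pose imax v := [arg max_(j > ord0) `|g j v|]%O.
have imaxP v j : `|g j v| <= `|g (imax v) v|.
  by rewrite /imax; case: arg_maxP => // i _; exact.
have imax0 v : l1 v = 1 -> g (imax v) v != 0.
  move=> v1; apply/eqP => g0; apply: nex; exists v; first exact: l1nz.
  by move=> j; apply/eqP; have := imaxP v j; rewrite g0 normr0 normr_le0.
have imaxN v : l1 v = 1 -> imax (- v) = imax v.
  move=> v1; rewrite /imax; congr (Order.arg_max _ _ _).
  by apply/funext => j; rewrite gN ?normrN //; exact: l1nz.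
pose code v : nat := ((imax v).*2 + (0 < g (imax v) v)%R)%N.
have code2 v : (code v)./2 = imax v.
  by rewrite /code addnC half_bit_double.
have codeodd v : odd (code v) = (0 < g (imax v) v)%R.
  by rewrite /code oddD odd_double addFb oddb.
have flip2 c : (flip c)./2 = c./2 by rewrite /flip; case: ifP; lia.
have codeN v : l1 v = 1 -> code (- v) = flip (code v).
  move=> v1; rewrite -[LHS]odd_double_half -[RHS]odd_double_half.
  rewrite flip2 !code2 odd_flip !codeodd imaxN // gN ?l1nz // oppr_gt0.
  by rewrite -leNgt le_eqVlt (negbTE (imax0 _ v1)).
(* Compactness makes the scale uniform: for some e > 0, no two points of the sphere closer than e
   have complementary labels. *)
have := (compact_near_coveringP [set v : 'rV[R]_d.+2 | l1 v = 1]).1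
  (@compact_l1_sphere R d.+1) _ (0^'+) (fun (e : R) u =>
    forall v, l1 v = 1 -> `|u - v| < e -> l1 u = 1 -> code u <> flip (code v)) _.
case=> [p p1|e /= e0 He].
  set M := `|g (imax p) p|.
  have M0 : 0 < M by rewrite normr_gt0; exact: imax0.
  have : \forall u \near p, forall i, `|g i p - g i u| < M / 4.
    apply: (@filter_forall _ _ (fun i u => `|g i p - g i u| < M / 4) _
      (nbhs_filter p)) => i.
    have := gc i p (l1nz _ p1); move/cvgrPdist_lt; apply.
    by rewrite divr_gt0.
  case/nbhs_normP => r /= r0 Hr.
  have r2 : 0 < r / 2 by rewrite divr_gt0.
  have pr : \forall u \near p, `|p - u| < r / 2.
    by apply/nbhs_normP; exists (r / 2).
  exists ([set u | `|p - u| < r / 2], [set e | e < r / 2]).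
    split=> //=.
    by apply: nbhs_right_lt.
  move=> [u e] /= [pu er] v v1 uv u1 cuv.
  have Hu := Hr u _; have Hv := Hr v _.
  have iuv : imax u = imax v.
    by apply: val_inj => /=; rewrite -code2 cuv flip2 code2.
  have ouv : (0 < g (imax u) u) = ~~ (0 < g (imax u) v).
    by rewrite -codeodd cuv odd_flip codeodd iuv.
  have {}Hu i : `|g i p - g i u| < M / 4 by apply: Hu => /=; lra.
  have {}Hv i : `|g i p - g i v| < M / 4.
    apply: Hv => /=; rewrite -(subrK u p) -addrA.
    by apply: le_lt_trans (ler_normD _ _) _; lra.
  have mu := imaxP u (imax p); have mv := imaxP v (imax p).
  rewrite -iuv in mv.
  (* Near [p] each component stays within M/4 of its value at [p], while the largest one exceeds
     3M/4 in absolute value. Opposite signs would put two values both less than M/2 and more than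
     3M/2 apart. *)
  have big w : `|g (imax p) p - g (imax p) w| < M / 4 ->
      `|g (imax p) w| <= `|g (imax u) w| -> 3 / 4 * M < `|g (imax u) w|.
    move=> pw; apply: lt_le_trans; have := ler_normD (g (imax p) p - g (imax p) w)
      (g (imax p) w).
    by rewrite subrK -/M; lra.
  move: (big u (Hu _) mu) (big v (Hv _) mv) (Hu (imax u)) (Hv (imax u)) ouv.
  move: (g (imax u) u) (g (imax u) v) (g (imax u) p) M0 => x y q M0.
  rewrite !ltr_norml; case: (ltP 0 x) => x0; case: (ltP 0 y) => // y0.
    by rewrite (gtr0_norm x0) (ler0_norm y0); lra.
  by rewrite (gtr0_norm y0) (ler0_norm x0); lra.
have [|||u [v [u1 v1 uv cuv]]] := @tucker R d.+1 code (e / 2).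
- by rewrite divr_gt0.
- exact: codeN.
- by move=> v _; rewrite code2.
apply: (He (e / 2) _ _ u u1 v) => //=.
- by rewrite /ball /= sub0r normrN gtr0_norm ?divr_gt0 //; lra.
- by rewrite divr_gt0.
- by apply: le_lt_trans uv; exact: mx_norm_le_l1.
Qed.

(** * Lines, the pairing with a spanning vector, and the (1,1) entry of a *-commutator *)

Section Line.
Variables (K : numClosedFieldType) (n : nat).
Implicit Types v w : 'rV[K]_n.+1.

Lemma dim_line_const1 : \dim <[const_mx 1 : 'rV[K]_n.+1]>%VS == 1%N.
Proof.
rewrite dim_vline eqb1; apply/eqP => /rowP /(_ 0) /eqP.
by rewrite !mxE oner_eq0.
Qed.

(* [line 0] is an arbitrary point. *)
Definition line v : CP K n :=
  insubd (exist (fun x : {vspace 'rV[K]_n.+1} => \dim x == 1%N) _ dim_line_const1)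
    <[v]>%VS.

Lemma val_line v : v != 0 -> \val (line v) = <[v]>%VS.
Proof. by move=> v0; rewrite /line val_insubd dim_vline v0. Qed.

Lemma lineN v : line (- v) = line v.
Proof.
congr insubd; apply/eqP; rewrite eqEsubv -!memvE.
by rewrite memvN memv_line -{1}(opprK v) memvN memv_line.
Qed.

(** Every nonzero vector whose line lies in [U] belongs to [CP_preimage U], which is open by the
    definition of the quotient topology. *)
Lemma line_continuous v : v != 0 -> {for v, continuous line}.
Proof.
move=> v0 A vA.
have : nbhs (line v : (CP K n : topologicalType)) A by exact: vA.
rewrite nbhsE => -[U [oU Uv] UA].
have oU' : open (CP_preimage U) by exact: oU.
suff: nbhs (v : ('rV[K]_n.+1 : topologicalType)) (line @^-1` A) by [].
rewrite nbhsE; exists (CP_preimage U).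
  by split=> //; exists (line v) => //; exact: val_line.
move=> w [x Ux xw]; apply: UA.
have w0 : w != 0.
  by apply/eqP => w0; have := valP x; rewrite xw w0 dim_vline eqxx.
by rewrite (_ : line w = x) //; apply: val_inj; rewrite /= val_line.
Qed.

Lemma dot0v v : dot 0 v = 0.
Proof. by apply: big1 => i _; rewrite mxE mul0r. Qed.

Lemma dot_conj_ge0 v : 0 <= dot v (conjv v).
Proof. by apply: sumr_ge0 => i _; rewrite mxE mul_conjC_ge0. Qed.

Lemma dot_conj_eq0 v : (dot v (conjv v) == 0) = (v == 0).
Proof.
apply/eqP/eqP => [vv|->]; last exact: dot0v.
apply/rowP => i; rewrite mxE.
have /psumr_eq0P : forall i, true -> 0 <= v 0 i * (conjv v) 0 i.
  by move=> j _; rewrite mxE mul_conjC_ge0.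
by move=> /(_ vv i isT) /eqP; rewrite mxE mul_conjC_eq0 => /eqP.
Qed.

Lemma PP_0 : PP K n 0.
Proof.
split=> [|x]; first exact: cst_continuous.
by split; rewrite /= /conjv ?raddf0 mem0v.
Qed.

(** This lets a section of the tautological bundle be replaced by a scalar function of [v] with the
    same zeros. *)
Lemma dot_conj_line_eq0 v w : v != 0 -> w \in \val (line v) ->
  dot w (conjv v) = 0 -> w = 0.
Proof.
move=> v0; rewrite val_line // => /vlineP[k ->]; rewrite dotZl => /eqP.
by rewrite mulf_eq0 dot_conj_eq0 (negbTE v0) orbF => /eqP ->; rewrite scale0r.
Qed.

(** The contributions of [a] cancel because scalars commute. *)
Lemma star_commutator11 (m : CP K n -> entries K n) x :
  (star_commutator m x).1.1 =
  dot (m x).1.2 (conjv (m x).1.2) - dot (m x).2.1 (conjv (m x).2.1).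
Proof.
have -> : star_commutator m x =
    fmul (m x) (fstar (m x)) - fmul (fstar (m x)) (m x) by [].
case: (m x) => [[a b] [c d]] /=.
by rewrite (dotC (conjv c)); ring.
Qed.

End Line.

(** * Real coordinates for complex vectors *)

Section ComplexCoordinates.
Variables (R : realType).

Lemma Re_continuous : continuous (fun z : C R => complex.Re z).
Proof.
move=> z; apply/(@cvgrPdist_lt R R^o (C R) (nbhs z) (nbhs_filter z)) => e e0.
apply/nbhs_ballP; exists (e%:C)%C; first by rewrite /= ltcR.
move=> w; rewrite /ball /= => zw; rewrite -ltcR.
by apply: le_lt_trans zw; have := normc_ge_Re (z - w); case: (z) (w) => [? ?] [? ?].
Qed.

Lemma Im_continuous : continuous (fun z : C R => complex.Im z).
Proof.
move=> z; apply/(@cvgrPdist_lt R R^o (C R) (nbhs z) (nbhs_filter z)) => e e0.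
apply/nbhs_ballP; exists (e%:C)%C; first by rewrite /= ltcR.
move=> w; rewrite /ball /= => zw; rewrite -ltcR.
(* Multiplication by i turns the imaginary part into minus a real part and keeps the modulus. *)
apply: le_lt_trans zw; have := normc_ge_Re ((z - w) * 'i%C).
rewrite normrM ReiNIm normrN (_ : `|'i%C| = 1) ?mulr1.
  by case: (z) (w) => [? ?] [? ?].
by rewrite normc_def /= expr0n add0r expr1n sqrtr1.
Qed.

Variable n : nat.

(* The last coordinate of [complex_vec v] is real: 2n+1 real coordinates suffice. *)
Definition complex_vec (v : 'rV[R]_(n + n).+1) : 'rV[C R]_n.+1 :=
  \row_k Complex (v 0 (inord k)) (if (k < n)%N then v 0 (inord (n.+1 + k)) else 0).

Lemma complex_vecN v : complex_vec (- v) = - complex_vec v.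
Proof.
by apply/rowP => k; rewrite !mxE; case: ifP; rewrite ?mxE // => _;
   apply/eqP; rewrite eq_complex /= ?oppr0 !eqxx.
Qed.

Lemma complex_vec_neq0 v : v != 0 -> complex_vec v != 0.
Proof.
apply: contra => /eqP /rowP v0; apply/eqP/rowP => i; rewrite mxE.
have [i_n|i_n] := ltnP i n.+1.
  have := v0 (Ordinal i_n); rewrite !mxE => -[+ _] /=.
  by rewrite inord_val.
have i_n' : (i - n.+1 < n.+1)%N by have := ltn_ord i; lia.
have := v0 (Ordinal i_n'); rewrite !mxE => -[_] /=.
rewrite subnKC // inord_val ifT //; have := ltn_ord i; lia.
Qed.

Lemma complex_vec_continuous : continuous complex_vec.
Proof.
move=> v A /nbhs_ballP[[e e'] /= e0 eA]; apply/nbhs_ballP.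
(* Radii are elements of [C R]; positivity forces a zero imaginary part. *)
have [e'0 e_gt0] : e' = 0 /\ 0 < e.
  by move: e0; rewrite ltcE /= => /andP[/eqP -> ->].
move: e0 eA; rewrite {}e'0 => e0 eA.
have normlt (a b : R) : `|a| < e / 2 -> `|b| < e / 2 ->
    `|Complex a b : C R| < Complex e 0.
  rewrite !ltr_norml normc_def => /andP[a1 a2] /andP[b1 b2].
  rewrite ltcR /= -(@ltr_pXn2r _ 2) ?nnegrE ?sqrtr_ge0 // ?ltW //.
  rewrite sqr_sqrtr ?addr_ge0 ?sqr_ge0 //; nra.
exists (e / 2); first by rewrite /= divr_gt0.
move=> u [_ uv]; apply: eA; split; first exact: e0.
move=> i k; rewrite ord1 !mxE /ball /=.
have H j : `|v 0 j - u 0 j| < e / 2 by exact: uv.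
by apply: normlt => //; case: ifP => // _; rewrite subrr normr0 divr_gt0.
Qed.

End ComplexCoordinates.

(** * Common zeros of n sections, and the norm bound *)

Section BorsukUlamSections.
Variables (R : realType) (n : nat).

Lemma exists_common_zero (m : 'I_n -> CP (C R) n -> entries (C R) n) :
  (forall i, PP (C R) n (m i)) -> exists x, forall i, (m i x).1.2 = 0.
Proof.
move=> mP.
pose g i (v : 'rV[C R]_n.+1) := dot (m i (line v)).1.2 (conjv v).
have gN i v : g i (- v) = - g i v.
  by rewrite /g lineN -scaleN1r conjvZ rmorphN1 dotZr mulN1r.
have gc i (v : 'rV[C R]_n.+1) : v != 0 -> g i u @[u --> v] --> g i v.
  move=> v0; apply: (dot_cvg (nbhs_filter v)).
    have [_ + _ _] := entries_cvg (line v) (mP i).1.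
    exact: (cvg_comp _ _ (line_continuous v0)).
  exact: conjv_continuous.
(* Real and imaginary parts give 2n odd functions of 2n+1 real variables. *)
pose part (j : 'I_(n + n)) (v : 'rV[R]_(n + n).+1) : R :=
  match fintype.split j with
  | inl i => complex.Re (g i (complex_vec v))
  | inr i => complex.Im (g i (complex_vec v))
  end.
have [j v v0|j v v0|v v0 gv0] := @borsuk_ulam R (n + n)%N part.
- have v0' := complex_vec_neq0 v0.
  rewrite /continuous_at /part; case: (fintype.split j) => i.
    have h := cvg_comp _ _ (@complex_vec_continuous R n v) (gc i _ v0').
    exact: (cvg_comp _ _ h (@Re_continuous R _)).
  have h := cvg_comp _ _ (@complex_vec_continuous R n v) (gc i _ v0').
  exact: (cvg_comp _ _ h (@Im_continuous R _)).
- rewrite /part complex_vecN; case: (fintype.split j) => i; rewrite gN;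
  by case: (g i _).
have v0' := complex_vec_neq0 v0.
exists (line (complex_vec v)) => i.
apply: (dot_conj_line_eq0 v0').
  by have [_ /(_ (line (complex_vec v)))[]] := mP i.
rewrite -/(g i _).
have := gv0 (unsplit (inl i)); have := gv0 (unsplit (inr i)).
by rewrite /part !unsplitK; case: (g i _) => a b /= -> ->.
Qed.

(** The image of (1, 0) is the first column, of squared norm |a|^2 + |c|^2. *)
Lemma hnorm_frep_ge1 (M : entries (C R) n) :
  M.1.1 <= -1 -> 1 <= hnorm (frep M (1, 0)).
Proof.
case: M => [[a b] [c d]] /= a1.
rewrite /hnorm /hinner /= dotC dot0v mulr1 addr0 scale1r scaler0 addr0.
have a0 : a <= 0 by rewrite (le_trans a1) // lerN10.
have : 1 <= a * Num.conj a + dot c (conjv c).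
  rewrite -[leLHS]addr0 lerD ?dot_conj_ge0 //.
  by rewrite -normCK ler0_norm // exprn_ege1 // lerNr.
rewrite lecE => /andP[_]; rewrite /= => h.
by rewrite -sqrtr1 ler_sqrt // (le_trans ler01).
Qed.

End BorsukUlamSections.

Theorem theorem2p1 (R : realType) (n : nat) :
  (forall T : CP (C R) n -> entries (C R) n,
      PP (C R) n T -> sum_of_star_commutators n T ->
      (1 <= PPnorm (T - (PPp (C R) n - PPq (C R) n))%R)%E) /\
  (exists T : CP (C R) n -> entries (C R) n,
      [/\ PP (C R) n T, sum_of_star_commutators n T &
          PPnorm (T - (PPp (C R) n - PPq (C R) n)) = 1%E]).
Proof.
have lower (T : CP (C R) n -> entries (C R) n) : sum_of_star_commutators n T ->
    (1 <= PPnorm (T - (PPp (C R) n - PPq (C R) n))%R)%E.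
  move=> [m [mP ->]]; have [x mx0] := exists_common_zero mP.
  set M := (_ - _ : CP (C R) n -> entries (C R) n).
  (* At the common zero each *-commutator has (1,1) entry -|c_i|^2, and P - Q subtracts a further
     1. *)
  have M11 : (M x).1.1 <= -1.
    have -> : (M x).1.1 = ((\sum_(i < n) star_commutator (m i)) x).1.1 - (1 - 0).
      by [].
    rewrite fct_sumE subr0 -[leRHS]add0r lerD2r.
    rewrite (big_morph (fun N : entries (C R) n => N.1.1)
      (id1 := 0) (op1 := +%R)) //.
    apply: sumr_le0 => i _; rewrite star_commutator11 mx0.
    rewrite dot0v sub0r oppr_le0.
    exact: dot_conj_ge0.
  apply: (@le_trans _ _ (fnorm x (M x))); last by apply: ereal_sup_ubound; exists x.
  apply: (@le_trans _ _ (hnorm (frep (M x) (1, 0)))%:E).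
    by rewrite lee_fin hnorm_frep_ge1.
  apply: ereal_sup_ubound; exists (1, 0) => //; split.
    by rewrite /hspace /= /conjv raddf0 mem0v.
  rewrite /hnorm /hinner /= dot0v rmorph1 mulr1 addr0.
  by rewrite sqrtr1.
split=> [T _|]; first exact: lower.
have comm0 : sum_of_star_commutators n (0 : CP (C R) n -> entries (C R) n).
  exists (fun _ => 0); split=> [_|]; first exact: PP_0.
  rewrite big1 // => i _; rewrite /star_commutator.
  suff -> : PPstar (0 : CP (C R) n -> entries (C R) n) = 0 by rewrite subrr.
  by apply/funext => x; rewrite /PPstar /= /conjv rmorph0 raddf0.
exists 0; split=> //; first exact: PP_0.
apply/eqP; rewrite eq_le lower // andbT.
apply: ge_ereal_sup => _ [x _ <-]; apply: ge_ereal_sup => _ [[s t] [_ st1] <-].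
rewrite lee_fin; apply: le_trans st1; rewrite le_eqVlt; apply/orP; left; apply/eqP.
(* For T = 0 the difference is Q - P, in every fibre the unitary diag(-1, 1), which preserves
   [hnorm]. *)
have -> : (0 - (PPp (C R) n - PPq (C R) n)) x = ((-1, 0), (0, 1)).
  transitivity (((0 - (1 - 0), 0 - (0 - 0)), (0 - (0 - 0), 0 - (0 - 1))) :
    entries (C R) n) => //.
  rewrite !(subr0, sub0r, opprK, oppr0). reflexivity.
rewrite /hnorm /hinner /= dot0v addr0 scaler0 scale1r add0r.
by rewrite mulN1r rmorphN mulrNN.
Qed.
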